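(* Let $d\ge1$ and fix $\gamma>0$. Then for every integer $k\ge0$, \[ \lim_{\nu\to+\infty}\alpha_k^{(\nu,\gamma)}=\begin{cases}1,&k=0,\\0,&k\neq0.\end{cases} \]
   Context: For $\nu>0$, $\alpha_k^{(\nu,\gamma)}=\frac{\Gamma(k+\frac d2)}{k!\,\Gamma(\frac d2)\Gamma(\nu)}\gamma^{2k}\int_0^{\infty}e^{-a}a^{\nu+\frac d2-1}(a+\gamma^2)^{-k-\frac d2}\,da$. *)

(* Defs.v *)
From HB Require Import structures.
From mathcomp Require Import all_boot all_order all_algebra.
From mathcomp Require Import all_classical all_reals all_analysis.
Set Implicit Arguments. Unset Strict Implicit. Unset Printing Implicit Defensive.
Import Order.TTheory GRing.Theory Num.Theory.
Local Open Scope classical_set_scope.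
Local Open Scope ring_scope.

Definition Gamma {R : realType} (s : R) : R :=
  Rintegral lebesgue_measure `]0, +oo[%classic
    (fun t : R => expR (- t) * t `^ (s - 1)).

Definition alpha {R : realType} (d k : nat) (nu g : R) : R :=
  Gamma (k%:R + d%:R / 2) / (k`!%:R * Gamma (d%:R / 2) * Gamma nu)
  * g ^+ (2 * k)
  * Rintegral lebesgue_measure `]0, +oo[%classic
      (fun a : R => expR (- a) * a `^ (nu + d%:R / 2 - 1)
                    * (a + g ^+ 2) `^ (- (k%:R + d%:R / 2))).

(* Main.v *)
Require Import Defs.
From HB Require Import structures.
From mathcomp Require Import all_boot all_order all_algebra.
From mathcomp Require Import all_classical all_reals all_analysis.
From mathcomp Require Import measurable_realfun ring lra.
Import Order.TTheory GRing.Theory Num.Theory.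
Import numFieldNormedType.Exports.
Local Open Scope classical_set_scope.
Local Open Scope ring_scope.

(* Put h = d/2 and c = g^2. Since a^(nu+h-1) (a+c)^(-k-h) equals
   a^(nu-1) (a/(a+c))^h (a+c)^(-k), the integral in alpha is a perturbation of
   Gamma(nu). For k = 0, Bernoulli's inequality 1 - h c/a <= (a/(a+c))^h <= 1
   gives 1 - h c/(nu-1) <= alpha <= 1. For k > 0, the bound
   c^(k-1) (a+c)^(-k) <= 1/a gives 0 <= alpha <= C/(nu-1) with C independent of
   nu. In both cases the factor 1/a turns Gamma(nu) into
   Gamma(nu-1) = Gamma(nu)/(nu-1). *)

(** * Antiderivatives and integrals over the open half-line *)

Lemma itv0y_bigcup (R : realType) :
  `]0, +oo[%classic = \bigcup_i `[i.+1%:R^-1 : R, +oo[%classic.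
Proof.
apply/seteqP; split=> x /=; rewrite in_itv/= andbT.
(* With [i] the integer part of [x^-1], [x^-1 < i.+1], so that [i.+1%:R^-1 <= x]. *)
- move=> x0; exists (Num.truncn x^-1) => //=; rewrite in_itv/= andbT.
  rewrite -[leRHS]invrK lef_pV2 ?posrE ?invr_gt0 ?ltr0n//.
  exact/ltW/truncnS_gt.
- move=> [i _] /=; rewrite in_itv/= andbT; apply: lt_le_trans.
  by rewrite invr_gt0 ltr0n.
Qed.

(** The endpoint 0 is left out because the Gamma integrand may blow up there. The closed rays
    starting at [i.+1%:R^-1] avoid it, and monotone convergence, for which [f] must be nonnegative,
    passes to their union. *)
Lemma ge0_integral_FTC_0y {R : realType} {f F : R -> R} {l L : R} :
  (forall x : R, 0 < x -> 0 <= f x) ->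
  (forall x : R, 0 < x -> {for x, continuous f}) ->
  (forall x : R, 0 < x -> is_derive x 1 F (f x)) ->
  F x @[x --> +oo] --> l -> F x @[x --> 0^'+] --> L ->
  (\int[lebesgue_measure]_(x in `]0%R, +oo[) (f x)%:E = (l - L)%:E)%E.
Proof.
move=> f0 cf dF Fl FL.
have a0 i : 0 < (i.+1%:R^-1 : R) by rewrite invr_gt0 ltr0n.
rewrite itv0y_bigcup.
set u := (fun i => \int[lebesgue_measure]_(x in `[(i.+1%:R^-1 : R)%R, +oo[) (f x)%:E)%E.
set I := (X in X = _).
(* The integrals over the rays have two limits, one by exhaustion and one through [F]; uniqueness of
   limits equates them. *)
suff [uI ul] : u @ \oo --> I /\ u @ \oo --> (l - L)%:E.
  by rewrite -(cvg_lim _ uI)//; exact: cvg_lim.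
split.
- apply: ge0_nondecreasing_set_cvg_integral => //.
  + move=> m n mn; rewrite subsetEset => x /=; rewrite !in_itv/= !andbT.
    by apply: le_trans; rewrite lef_pV2 ?posrE ?ltr0n// ler_nat.
  + move=> i; apply/measurable_EFinP.
    have mf : measurable_fun `]0 : R, +oo[%classic f.
      apply: open_continuous_measurable_fun => // x.
      by rewrite inE/= in_itv/= andbT; exact: cf.
    apply: measurable_funS mf => // x /=; rewrite !in_itv/= !andbT.
    exact: lt_le_trans.
  + move=> i x /=; rewrite in_itv/= andbT => ix; rewrite lee_fin f0//.
    exact: lt_le_trans ix.
- have -> : u = (fun i => (l - F i.+1%:R^-1)%:E).
    apply/funext => i; rewrite /u (@ge0_continuous_FTC2y _ f F _ l)//.
    + by move=> x ix; apply/f0/(lt_le_trans _ ix).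
    + apply: continuous_in_subspaceT => x; rewrite inE/= in_itv/= andbT => ix.
      by apply/cf/(lt_le_trans _ ix).
    + by move=> x ix; have [] := dF x (lt_trans (a0 i) ix).
    + apply: cvg_at_right_filter; apply: differentiable_continuous.
      by apply/derivable1_diffP; have [] := dF _ (a0 i).
    + move=> x; rewrite in_itv/= andbT => ix.
      have := dF x (lt_trans (a0 i) ix) => dFx.
      by rewrite derive1E derive_val.
  apply/fine_cvgP; split; first exact: nearW.
  apply: cvgB; first exact: cvg_cst.
  move/cvg_at_rightP : FL; apply; split=> //.
  exact: cvg_harmonic.
Qed.

(** * Exponential decay: bounds, derivatives and a reference integral *)

Lemma powR_expRN_le {R : realType} {p : R} : 0 < p ->
  exists2 K, 0 < K & forall t : R, 0 <= t -> t `^ p * expR (- t) <= K * expR (- (t / 2)).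
Proof.
(* The constant comes from raising [t / (2 * p) <= expR (t / (2 * p))] to the power [p], which
   bounds [t]^ p[by](2 * p) [^ p * expR (t / 2)]. *)
move=> p0; exists ((2 * p) `^ p) => [|t t0]; first by rewrite powR_gt0// mulr_gt0.
have -> : expR (- t) = expR (- (t / 2)) * expR (- (t / 2)).
  by rewrite -expRD; congr expR; field.
rewrite mulrA ler_wpM2r ?expR_ge0// expRN ler_pdivrMr ?expR_gt0//.
have -> : t / 2 = (t / (2 * p)) * p by field; rewrite gt_eqF.
rewrite expRM -powRM ?expR_ge0 ?mulr_ge0 ?(ltW p0)//.
rewrite ge0_ler_powR ?nnegrE ?expR_ge0 ?mulr_ge0 ?(ltW p0)//.
rewrite mulrC -ler_pdivrMr ?mulr_gt0//; apply: le_trans (expR_ge1Dx _).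
by rewrite lerDr.
Qed.

Lemma is_derive_expRN {R : realType} (c x : R) :
  is_derive x 1 (fun t => expR (- (t * c))) (- c * expR (- (x * c))).
Proof.
have -> : (fun t : R => expR (- (t * c))) = expR \o ( *%R (- c)).
  by apply/funext => t /=; rewrite mulNr mulrC.
have h : is_derive x 1 ( *%R (- c)) (- c).
  by apply: is_derive_eq; rewrite -[RHS]mulr1.
have e : expR (- (x * c)) = expR (- c * x) by rewrite mulNr mulrC.
by rewrite e mulrC; exact: is_derive1_comp.
Qed.

Lemma is_derive_powR_expRN {R : realType} (s : R) {x : R} : 0 < x ->
  is_derive x 1 (fun t => t `^ s * expR (- t))
    (s * x `^ (s - 1) * expR (- x) - x `^ s * expR (- x)).
Proof.
move=> x0.
have h1 := is_derive1_powR s x0.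
have := is_derive_expRN 1 x.
under eq_fun do rewrite mulr1.
rewrite mulr1 => h2.
have -> : (fun t => t `^ s * expR (- t)) = (powR (R:=R))^~ s * (fun t => expR (- t)).
  by [].
apply: is_derive_eq.
rewrite /GRing.scale/=; ring.
Qed.

Lemma continuous_powR_expRN {R : realType} (s : R) {x : R} : 0 < x ->
  {for x, continuous (fun t => t `^ s * expR (- t))}.
Proof.
move=> x0; apply: differentiable_continuous; apply/derivable1_diffP.
by have [] := is_derive_powR_expRN s x0.
Qed.

Lemma cvg_expRN_half {R : realType} : expR (- (x / 2)) @[x --> +oo] --> (0 : R).
Proof.
apply: (cvg_comp (fun x => x / 2) (fun x => expR (- x))); last exact: cvgr_expR.
apply/cvgryPge => A.
have : \forall x \near +oo, A * 2 <= x by apply: nbhs_pinfty_ge; exact: num_real.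
by apply: filterS => x; rewrite ler_pdivlMr.
Qed.

Lemma integral_expRN_half {R : realType} :
  (\int[lebesgue_measure]_(x in `]0%R, +oo[) (expR (- (x / 2)))%:E = (2 : R)%:E)%E.
Proof.
have d (x : R) : is_derive x 1 (fun t : R => - 2 * expR (- (t / 2))) (expR (- (x / 2))).
  have h := is_derive_expRN (2^-1) x.
  have -> : (fun t : R => - 2 * expR (- (t / 2))) =
    (- 2 : R) *: (fun t : R => expR (- (t / 2))) by [].
  apply: is_derive_eq; rewrite /GRing.scale/=; by field.
have c (x : R) : {for x, continuous (fun t : R => expR (- (t / 2)))}.
  apply: differentiable_continuous; apply/derivable1_diffP.
  by have [] := is_derive_expRN (2^-1) x.
rewrite (@ge0_integral_FTC_0y _ _ (fun t : R => - 2 * expR (- (t / 2))) 0 (- 2))//.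
- by rewrite sub0r opprK.
- rewrite -[X in _ --> X](mulr0 (- 2)).
  by apply: cvgM; [exact: cvg_cst|exact: cvg_expRN_half].
- apply: cvg_at_right_filter.
  rewrite [X in _ --> X](_ : _ = - 2 * expR (- (0 / 2))).
    by apply: cvgM; [exact: cvg_cst|exact: c].
  by rewrite mul0r oppr0 expR0 mulr1.
Qed.

(** * The Gamma integral: convergence, functional equation, positivity *)

Definition gamma_fun {R : realType} (s t : R) : R := expR (- t) * t `^ (s - 1).

Lemma gamma_fun_ge0 {R : realType} (s t : R) : 0 <= gamma_fun s t.
Proof. by rewrite mulr_ge0 ?expR_ge0 ?powR_ge0. Qed.

Lemma measurable_gamma_fun {R : realType} (s : R) (D : set R) :
  measurable_fun D (gamma_fun s).
Proof.
apply: measurable_funM.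
  by apply: measurableT_comp => //; exact: measurableT_comp.
apply: measurable_funTS; exact: measurable_powR.
Qed.

Lemma ge0_le_integrable_0y {R : realType} {f g : R -> R} :
  measurable_fun [set: R] f ->
  (forall x : R, 0 < x -> 0 <= f x <= g x) ->
  lebesgue_measure.-integrable `]0, +oo[ (EFin \o g) ->
  lebesgue_measure.-integrable `]0, +oo[ (EFin \o f).
Proof.
move=> mf fg; apply: le_integrable => //; first by apply/measurable_EFinP; exact: measurable_funTS.
move=> x /=; rewrite in_itv/= andbT => /fg /andP[f0 fg0].
by rewrite lee_fin !ger0_norm// (le_trans f0).
Qed.

Lemma integrableZl_0y {R : realType} (k : R) {f : R -> R} :
  lebesgue_measure.-integrable `]0, +oo[ (EFin \o f) ->
  lebesgue_measure.-integrable `]0, +oo[ (EFin \o (fun x => k * f x)).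
Proof. by move=> fi; apply: (integrableZl _ k fi). Qed.

(* The correction by a multiple of [expR (- (t / 2))] makes the derivative of
   [t `^ s * expR (- t)] nonnegative, so that a single monotone integration
   yields both the integrability and the functional equation. *)
Lemma integrable_Gamma_recurrence {R : realType} {s : R} : 0 < s ->
  [/\ lebesgue_measure.-integrable `]0, +oo[ (EFin \o gamma_fun s),
      lebesgue_measure.-integrable `]0, +oo[ (EFin \o gamma_fun (s + 1)) &
      Gamma (s + 1) = s * Gamma s].
Proof.
move=> s0; have [K K0 HK] := powR_expRN_le s0.
pose e (t : R) := expR (- (t / 2)).
have me (D : set R) : measurable_fun D e.
  by do 2!apply: measurableT_comp => //; apply: measurable_funM.
have ie : lebesgue_measure.-integrable `]0, +oo[ (EFin \o e).
  apply/integrableP; split; first by apply/measurable_EFinP; exact: me.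
  under eq_integral do rewrite /= ger0_norm ?expR_ge0//.
  by rewrite integral_expRN_half ltry.
have gS t : gamma_fun (s + 1) t = t `^ s * expR (- t).
  by rewrite /gamma_fun addrK mulrC.
(* At [s + 1] the integrand is bounded near 0, so [K * e] dominates it directly; at [s] a
   singularity at 0 is possible. *)
have i1 : lebesgue_measure.-integrable `]0, +oo[ (EFin \o gamma_fun (s + 1)).
  apply: (ge0_le_integrable_0y _ _ (integrableZl_0y K ie)).
    exact: measurable_gamma_fun.
  by move=> t t0; rewrite gamma_fun_ge0/= gS HK// ltW.
pose f t := s * gamma_fun s t - gamma_fun (s + 1) t + K * e t.
have fge t : 0 < t -> s * gamma_fun s t <= f t.
  by move=> t0; rewrite /f gS -addrA lerDl addrC subr_ge0 HK// ltW.
have mf (D : set R) : measurable_fun D f.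
  apply: measurable_funD; last by apply: measurable_funM.
  apply: measurable_funB; last exact: measurable_gamma_fun.
  by apply: measurable_funM => //; exact: measurable_gamma_fun.
have f0 t : 0 < t -> 0 <= f t.
  by move=> t0; apply: le_trans (fge t t0); rewrite mulr_ge0 ?gamma_fun_ge0 ?(ltW s0).
have If : (\int[lebesgue_measure]_(x in `]0%R, +oo[) (f x)%:E = (2 * K)%:E)%E.
  have c (x : R) : {for x, continuous e}.
    apply: differentiable_continuous; apply/derivable1_diffP.
    by have [] := is_derive_expRN (2^-1) x.
  (* The factor [- (2 * K)] compensates the derivative [- e / 2] of [e]. As [s > 0], only this term
     survives at 0, so [F] runs from [- (2 * K)] to 0. *)
  pose F := (fun t : R => t `^ s * expR (- t)) + (- (2 * K)) *: e.
  have cf (x : R) : 0 < x -> {for x, continuous f}.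
    move=> x0.
    have -> : f = s *: (fun t => t `^ (s - 1) * expR (- t)) -
        (fun t => t `^ s * expR (- t)) + K *: e.
      apply/funext => t; rewrite /f gS /gamma_fun; congr (_ - _ + _).
      by rewrite [expR _ * _]mulrC.
    apply: continuousD; last by apply: continuousZr; exact: c.
    apply: continuousB; last exact: continuous_powR_expRN.
    by apply: continuousZr; exact: continuous_powR_expRN.
  have dF (x : R) : 0 < x -> is_derive x 1 F (f x).
    move=> x0; have h1 := is_derive_powR_expRN s x0.
    have h2 : is_derive x 1 e _ := is_derive_expRN (2^-1) x.
    apply: (is_derive_eq (is_deriveD h1 (is_deriveZ (- (2 * K)) h2))).
    rewrite /f gS /gamma_fun /e /GRing.scale/=; by field.
  have F0 : F x @[x --> +oo] --> (0 : R).
    rewrite -[X in _ --> X](addr0 0); apply: cvgD.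
      apply: (squeeze_cvgr (f := fun=> 0) (h := fun x => K * e x)).
      + have : \forall x \near +oo, (0 : R) <= x by apply: nbhs_pinfty_ge; exact: num_real.
        apply: filterS => x x0.
        by rewrite mulr_ge0 ?powR_ge0 ?expR_ge0//= HK.
      + exact: cvg_cst.
      + rewrite -[X in _ --> X](mulr0 K).
        by apply: cvgM; [exact: cvg_cst|exact: cvg_expRN_half].
    rewrite -[X in _ --> X](mulr0 (- (2 * K))).
    by apply: cvgM; [exact: cvg_cst|exact: cvg_expRN_half].
  have FK : F x @[x --> 0^'+] --> - (2 * K).
    rewrite -[X in _ --> X](add0r); apply: cvgD.
      rewrite -[X in _ --> X](mul0r (expR (- 0))).
      apply: cvgM; first exact: powR_cvg0.
      apply: cvg_at_right_filter; apply: continuous_comp; last exact: continuous_expR.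
      exact: opp_continuous.
    apply: cvg_at_right_filter.
    rewrite [X in _ --> X](_ : _ = - (2 * K) * e 0).
      by apply: cvgM; [exact: cvg_cst|exact: c].
    by rewrite /e mul0r oppr0 expR0 mulr1.
  by rewrite (ge0_integral_FTC_0y f0 cf dF F0 FK) sub0r opprK.
have i_f : lebesgue_measure.-integrable `]0, +oo[ (EFin \o f).
  apply/integrableP; split; first by apply/measurable_EFinP; exact: mf.
  rewrite [ltLHS](_ : _ = (2 * K)%:E) ?ltry// -If.
  apply: eq_integral => x; rewrite inE/= in_itv/= andbT => x0.
  by rewrite ger0_norm ?f0.
have i0 : lebesgue_measure.-integrable `]0, +oo[ (EFin \o gamma_fun s).
  apply: (ge0_le_integrable_0y _ _ (integrableZl_0y s^-1 i_f)).
    exact: measurable_gamma_fun.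
  by move=> t t0; rewrite gamma_fun_ge0/= mulrC ler_pdivlMr// mulrC fge.
split=> //.
(* Integrated termwise, [f] gives [s * Gamma s - Gamma (s + 1) + 2 * K]; comparison with [2 * K]
   leaves the functional equation. *)
have : Rintegral lebesgue_measure `]0, +oo[%classic f = 2 * K by rewrite /Rintegral If.
have is0 := integrableZl_0y s i0.
have iK := integrableZl_0y K ie.
rewrite RintegralD//; last exact: (integrableB _ is0 i1).
rewrite RintegralB// !RintegralZl//.
rewrite [X in _ + K * X]/Rintegral integral_expRN_half/= -/(Gamma s) -/(Gamma (s + 1)).
by move=> h; lra.
Qed.

Lemma Gamma_gt0 {R : realType} {s : R} : 0 < s -> 0 < Gamma s.
Proof.
move=> s0; have [i0 _ _] := integrable_Gamma_recurrence s0.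
pose c : R := expR (- 2) / 2.
have c0 : 0 < c by rewrite divr_gt0 ?expR_gt0.
have gc t : 1 <= t <= 2 -> c <= gamma_fun s t.
  move=> /andP[t1 t2]; apply: ler_pM; rewrite ?invr_ge0 ?expR_ge0 ?ler_expR ?lerN2//.
  have t0 : 0 < t by exact: lt_le_trans t1.
  apply: (@le_trans _ _ (t `^ (- 1))); first by rewrite powR_inv1 ?(ltW t0)// lef_pV2 ?posrE.
  by rewrite ler_powR// lerDr ltW.
have cI : (c%:E <= \int[lebesgue_measure]_(x in `]0%R, +oo[) (gamma_fun s x)%:E)%E.
  apply: (@le_trans _ _ (\int[lebesgue_measure]_(x in `[1%R, 2%R]) (gamma_fun s x)%:E)%E).
    apply: (@le_trans _ _ (\int[lebesgue_measure]_(x in `[1%R : R, 2%R]) c%:E)%E).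
      rewrite integral_cst//= lebesgue_measure_itv/= lte_fin ltr1n -EFinB.
      by rewrite -[X in (X - _)%:E]/(1 + 1) addrK mule1.
    apply: ge0_le_integral => //.
    - by move=> x _; rewrite lee_fin ltW.
    - by apply/measurable_EFinP; exact: measurable_gamma_fun.
  apply: ge0_subset_integral => //.
  - by apply/measurable_EFinP; exact: measurable_gamma_fun.
  - by move=> x _; rewrite lee_fin gamma_fun_ge0.
  - move=> x /=; rewrite !in_itv/= andbT => /andP[x1 _]; exact: lt_le_trans x1.
(* Finiteness matters as well: [fine] would send an infinite integral to 0. *)
apply: fine_gt0; apply/andP; split; first by apply: lt_le_trans cI; rewrite lte_fin.
by rewrite ltey_eq integrable_fin_num.
Qed.

(** * Pointwise comparison of the two integrands *)

Definition alpha_fun {R : realType} (k : nat) (h c nu a : R) : R :=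
  expR (- a) * a `^ (nu + h - 1) * (a + c) `^ (- (k%:R + h)).

Lemma measurable_alpha_fun {R : realType} (k : nat) (h c nu : R) (D : set R) :
  measurable_fun D (alpha_fun k h c nu).
Proof.
apply: measurable_funM; first exact: (measurable_gamma_fun (nu + h)).
apply: (@measurableT_comp _ _ _ _ _ _ (@powR R ^~ (- (k%:R + h)))).
  exact: measurable_powR.
exact: measurable_funD.
Qed.

Lemma alpha_fun_ge0 {R : realType} (k : nat) (h c nu a : R) :
  0 <= alpha_fun k h c nu a.
Proof. by rewrite !mulr_ge0 ?expR_ge0 ?powR_ge0. Qed.

Lemma alpha_funE {R : realType} (k : nat) {h c : R} (nu : R) {a : R} :
  0 < c -> 0 < a ->
  alpha_fun k h c nu a = gamma_fun nu a * (a / (a + c)) `^ h / (a + c) ^+ k.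
Proof.
move=> c0 a0; have ac0 : 0 < a + c by rewrite addr_gt0.
rewrite /alpha_fun /gamma_fun addrAC [a `^ (_ + h)]powRD ?(gt_eqF a0) ?implybT//.
rewrite opprD [(a + c) `^ _]powRD ?(gt_eqF ac0) ?implybT// powR_invn ?(ltW ac0)//.
rewrite powRM ?invr_ge0 ?(ltW a0) ?(ltW ac0)//.
by rewrite -(powR_inv1 (ltW ac0)) -powRrM mulN1r !mulrA mulrAC.
Qed.

Lemma gamma_fun_div {R : realType} {nu a : R} :
  0 < a -> gamma_fun nu a / a = gamma_fun (nu - 1) a.
Proof.
move=> a0; rewrite /gamma_fun -mulrA; congr (_ * _).
by rewrite -(powR_inv1 (ltW a0)) -powRD ?(gt_eqF a0) ?implybT.
Qed.

Lemma powR_ratio_le1 {R : realType} {h c a : R} : 0 <= h -> 0 < c -> 0 < a ->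
  (a / (a + c)) `^ h <= 1.
Proof.
move=> h0 c0 a0; have ac0 : 0 < a + c by rewrite addr_gt0.
apply: (@le_trans _ _ (1 `^ h)); last by rewrite powR1.
rewrite ge0_ler_powR ?nnegrE ?divr_ge0 ?(ltW a0) ?(ltW ac0)//.
by rewrite ler_pdivrMr// mul1r lerDl ltW.
Qed.

(** The power equals [expR (- h * ln (1 + c / a))]; apply [1 + x <= expR x], then [ln (1 + y) <= y].
    This covers every real exponent [h >= 0], including [h = 1 / 2]. *)
Lemma powR_ratio_ge {R : realType} {h c a : R} : 0 <= h -> 0 < c -> 0 < a ->
  1 - h * (c / a) <= (a / (a + c)) `^ h.
Proof.
move=> h0 c0 a0; have ac0 : 0 < a + c by rewrite addr_gt0.
have -> : a / (a + c) = (1 + c / a)^-1 by field; rewrite !gt_eqF.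
have ca0 : 0 < c / a by rewrite divr_gt0.
rewrite /powR gt_eqF ?invr_gt0 ?addr_gt0// lnV ?posrE ?addr_gt0//.
apply: le_trans (expR_ge1Dx _); rewrite lerD2l mulrN lerN2 ler_wpM2l//.
by apply: le_ln1Dx; rewrite (lt_trans _ ca0).
Qed.

(** * Bounds on the integral with error of order [(nu - 1)^-1] *)

Lemma cvg_inv_subr1 {R : realType} : (x - 1)^-1 @[x --> +oo] --> (0 : R).
Proof.
apply/gtr0_cvgV0.
  have : \forall x \near +oo, (1 : R) < x by apply: nbhs_pinfty_gt; exact: num_real.
  by apply: filterS => x; rewrite subr_gt0.
apply/cvgryPge => A.
have : \forall x \near +oo, A + 1 <= x by apply: nbhs_pinfty_ge; exact: num_real.
by apply: filterS => x; rewrite lerBrDr.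
Qed.

Lemma Rintegral_alpha_fun0_bounds {R : realType} {h c nu : R} :
  0 < h -> 0 < c -> 1 < nu ->
  Gamma nu * (1 - h * c / (nu - 1)) <=
    \int[lebesgue_measure]_(a in `]0, +oo[) alpha_fun 0 h c nu a <= Gamma nu.
Proof.
move=> h0 c0 nu1; have nu10 : 0 < nu - 1 by rewrite subr_gt0.
(* Used at [nu - 1], which is why [nu > 1] is assumed: one call gives integrability at both [nu - 1]
   and [nu]. *)
have [i1 + Gnu] := integrable_Gamma_recurrence nu10.
rewrite subrK in Gnu *; move=> i0.
have ub a : 0 < a -> alpha_fun 0 h c nu a <= gamma_fun nu a.
  move=> a0; rewrite alpha_funE// expr0 divr1 ler_piMr ?gamma_fun_ge0//.
  by rewrite powR_ratio_le1 ?(ltW h0).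
have ia : lebesgue_measure.-integrable `]0, +oo[ (EFin \o alpha_fun 0 h c nu).
  apply: (ge0_le_integrable_0y _ _ i0); first exact: measurable_alpha_fun.
  by move=> a a0; rewrite alpha_fun_ge0 ub.
apply/andP; split; last first.
  by apply: le_Rintegral => // a; rewrite /= in_itv/= andbT; exact: ub.
have -> : Gamma nu * (1 - h * c / (nu - 1)) =
    \int[lebesgue_measure]_(a in `]0, +oo[) (gamma_fun nu a - h * c * gamma_fun (nu - 1) a).
  rewrite RintegralB//; last exact: integrableZl_0y.
  rewrite RintegralZl// -/(Gamma nu) -/(Gamma (nu - 1)) Gnu.
  by field; rewrite gt_eqF.
apply: le_Rintegral => //.
  exact: (integrableB _ i0 (integrableZl_0y (h * c) i1)).
move=> a; rewrite /= in_itv/= andbT => a0.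
rewrite alpha_funE// expr0 divr1 -(gamma_fun_div a0).
apply: le_trans (ler_wpM2l (gamma_fun_ge0 _ _) (powR_ratio_ge (ltW h0) c0 a0)).
by rewrite le_eqVlt; apply/orP; left; apply/eqP; field; rewrite gt_eqF.
Qed.

(** Of the [k.+1] factors [a + c] in the denominator, one is bounded below by [a], which lowers the
    Gamma parameter by one, and the other [k] by [c]. *)
Lemma Rintegral_alpha_funS_le {R : realType} (k : nat) {h c nu : R} :
  0 < h -> 0 < c -> 1 < nu ->
  c ^+ k * \int[lebesgue_measure]_(a in `]0, +oo[) alpha_fun k.+1 h c nu a
    <= Gamma nu / (nu - 1).
Proof.
move=> h0 c0 nu1; have nu10 : 0 < nu - 1 by rewrite subr_gt0.
have [i1 _ Gnu] := integrable_Gamma_recurrence nu10.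
rewrite subrK in Gnu.
have ub a : 0 < a -> alpha_fun k.+1 h c nu a <= c ^- k * gamma_fun (nu - 1) a.
  move=> a0; have ac0 : 0 < a + c by rewrite addr_gt0.
  have ca : c ^+ k * a <= (a + c) ^+ k.+1.
    by rewrite exprSr ler_pM ?exprn_ge0 ?lerXn2r ?nnegrE ?lerDl ?lerDr ?ltW.
  rewrite alpha_funE// -(gamma_fun_div a0) mulrCA -invfM.
  apply: ler_pM; rewrite ?mulr_ge0 ?gamma_fun_ge0 ?powR_ge0 ?invr_ge0 ?exprn_ge0 ?(ltW ac0)//.
    by rewrite ler_piMr ?gamma_fun_ge0// powR_ratio_le1 ?(ltW h0).
  by rewrite lef_pV2 ?posrE ?mulr_gt0 ?exprn_gt0.
have ia : lebesgue_measure.-integrable `]0, +oo[ (EFin \o alpha_fun k.+1 h c nu).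
  apply: (ge0_le_integrable_0y _ _ (integrableZl_0y (c ^- k) i1)).
    exact: measurable_alpha_fun.
  by move=> a a0; rewrite alpha_fun_ge0 ub.
rewrite mulrC -ler_pdivlMr ?exprn_gt0// Gnu [X in X / _]mulrAC divff ?gt_eqF// mul1r mulrC.
rewrite -RintegralZl//; apply: le_Rintegral => //; first exact: integrableZl_0y.
by move=> a; rewrite /= in_itv/= andbT; exact: ub.
Qed.

(** * The limit, by squeezing *)

Theorem theorem9 (R : realType) (d : nat) (g : R) (k : nat) :
  (1 <= d)%N -> 0 < g ->
  alpha d k nu g @[nu --> +oo] --> ((if k == 0%N then 1 else 0) : R^o).
Proof.
move=> d1 g0.
have h0 : 0 < d%:R / 2 :> R by rewrite divr_gt0// ltr0n.
have c0 : 0 < g ^+ 2 by rewrite exprn_gt0.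
have alphaE n nu : alpha d n nu g =
    Gamma (n%:R + d%:R / 2) / (n`!%:R * Gamma (d%:R / 2) * Gamma nu) * g ^+ (2 * n) *
    \int[lebesgue_measure]_(a in `]0, +oo[) alpha_fun n (d%:R / 2) (g ^+ 2) nu a by [].
have Gh0 := Gamma_gt0 h0.
have neargt1 : \forall nu \near +oo, (1 : R) < nu.
  by apply: nbhs_pinfty_gt; exact: num_real.
have cvgM0 (C : R) : C * (nu - 1)^-1 @[nu --> +oo] --> (0 : R).
  by rewrite -[X in _ --> X](mulr0 C); apply: cvgM; [exact: cvg_cst|exact: cvg_inv_subr1].
case: k => [|k] /=.
  apply: (squeeze_cvgr (f := fun nu => 1 - (d%:R / 2 * g ^+ 2) * (nu - 1)^-1) (h := fun=> 1)).
  - apply: filterS neargt1 => nu nu1.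
    have Gnu0 : 0 < Gamma nu by apply: Gamma_gt0; exact: lt_trans nu1.
    rewrite alphaE; move: (Rintegral_alpha_fun0_bounds h0 c0 nu1).
    set J := Rintegral _ _ _ => /andP[lb ub].
    (* For index 0 the two values [Gamma (d%:R / 2)] cancel, and the factorial and the power of [g]
       are 1. *)
    rewrite [X in _ <= X <= _](_ : _ = J / Gamma nu).
      by rewrite ler_pdivlMr// ler_pdivrMr// mulrC mul1r lb ub.
    rewrite add0r fact0 muln0 expr0; move: J (Gamma _) (Gamma nu) Gh0 Gnu0 {lb ub} => J x y x0 y0.
    by field; rewrite !gt_eqF.
  - rewrite -[X in _ --> X](subr0 1); apply: cvgB; [exact: cvg_cst|exact: cvgM0].
  - exact: cvg_cst.
(* Only one factor [g ^+ 2] of [g ^+ (2 * k.+1)] enters [C]; the remaining [(g ^+ 2) ^+ k] is the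
   weight [c ^+ k] of the integral bound. *)
pose C := Gamma (k.+1%:R + d%:R / 2) / ((k.+1)`!%:R * Gamma (d%:R / 2)) * g ^+ 2.
have Gkh0 : 0 < Gamma (k.+1%:R + d%:R / 2 : R).
  by apply: Gamma_gt0; rewrite addr_gt0 ?ltr0n.
have C0 : 0 <= C.
  exact: mulr_ge0 (divr_ge0 (ltW Gkh0) (mulr_ge0 (ler0n _ _) (ltW Gh0))) (ltW c0).
apply: (squeeze_cvgr (f := fun=> 0 : R) (h := fun nu : R => C * (nu - 1)^-1)).
- apply: filterS neargt1 => nu nu1.
  have Gnu0 : 0 < Gamma nu by apply: Gamma_gt0; exact: lt_trans nu1.
  rewrite alphaE; move: (Rintegral_alpha_funS_le k h0 c0 nu1).
  have : 0 <= \int[lebesgue_measure]_(a in `]0, +oo[)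
      alpha_fun k.+1 (d%:R / 2) (g ^+ 2) nu a.
    by apply: Rintegral_ge0 => a _; exact: alpha_fun_ge0.
  set J := Rintegral _ _ _ => J0 ub.
  rewrite [X in _ <= X <= _](_ : _ = C * ((g ^+ 2) ^+ k * J / Gamma nu)); last first.
    have F0 : 0 < (k.+1)`!%:R :> R by rewrite ltr0n fact_gt0.
    rewrite /C exprM exprS.
    move: J (Gamma _) (Gamma (d%:R / 2)) (Gamma nu) Gh0 Gnu0 {C C0 cvgM0 J0 ub Gkh0} => J z x y x0 y0.
    by field; rewrite !gt_eqF.
  have q0 := divr_ge0 (mulr_ge0 (exprn_ge0 k (ltW c0)) J0) (ltW Gnu0).
  rewrite (mulr_ge0 C0 q0)/=; apply: ler_wpM2l C0 _ _ _.
  by rewrite (ler_pdivrMr _ _ Gnu0) [leRHS]mulrC.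
- exact: cvg_cst.
- exact: cvgM0.
Qed.
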